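(* Let $m,n,p,q\in\mathbb N$, $g_1,\dots,g_p,h_1,\dots,h_q\in\mathbb N$, $g=g_1+\cdots+g_p$, $h=h_1+\cdots+h_q$. Let $A\in\mathbb C^{m\times n}$, $B=[B_1\ \cdots\ B_p]\in\mathbb C^{m\times g}$ with $B_i\in\mathbb C^{m\times g_i}$, and let $C\in\mathbb C^{h\times n}$ be the matrix obtained by stacking $C_j\in\mathbb C^{h_j\times n}$, $j=1,\dots,q$, as block rows (in this order). Let $Y\in\mathbb C^{m\times h}$. Let the matrices $B_r^{(r-1)}\in\mathbb C^{m\times g_r}$ ($r=1,\dots,p$) and $E=E_1\cdots E_{p-1}\in\mathbb C^{g\times g}$ be those produced from $B$ by the block reduction described in the context. Let $D_{B,rr}=[B_r^{(r-1)}]^*B_r^{(r-1)}$ for each $r=1,\dots,p$, and define the block diagonal matrices $$D_B=\operatorname{diag}[D_{B,11},\dots,D_{B,pp}],\qquad D_B^\dagger=\operatorname{diag}[D_{B,11}^\dagger,\dots,D_{B,pp}^\dagger].$$ Then the matrix $$X_+=E\,D_B^\dagger E^*B^*Y\in\mathbb C^{g\times h}$$ satisfies $B^*BX_+=B^*Y$, and hence minimizes $\|B^*Y-B^*BX\|_F$ over $X\in\mathbb C^{g\times h}$. Moreover, if $Y=AC^*F^*D_C^\dagger F$, where $F$ and $D_C^\dagger$ are the matrices constructed from $C$ in the context, then $X_+$ solves the equation $$B^*BXCC^*=B^*AC^* .$$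
   Context: $M^*$ denotes the conjugate transpose, $M^\dagger$ the Moore–Penrose inverse, and $\|\cdot\|_F$ the Frobenius norm. Block reduction of $B$: set $B^{(0)}=B$, with blocks $B_j^{(0)}=B_j$. For $r=1,\dots,p-1$ successively, given $$B^{(r-1)}=[B_1^{(0)}\ B_2^{(1)}\ \cdots\ B_r^{(r-1)}\ \ B_{r+1}^{(r-1)}\ \cdots\ B_p^{(r-1)}],$$ let $E_r\in\mathbb C^{g\times g}$ be the block upper triangular matrix, partitioned conformally with $g=g_1+\cdots+g_p$, whose diagonal blocks are identity matrices, whose $(r,j)$ block is $-[B_r^{(r-1)}]^\dagger B_j^{(r-1)}$ for each $j=r+1,\dots,p$, and whose other off-diagonal blocks are zero; then set $B^{(r)}=B^{(r-1)}E_r$. Thus the first $r$ blocks of $B^{(r)}$ are those of $B^{(r-1)}$, and for $j>r$ the $j$-th block is $B_j^{(r)}=(I-B_r^{(r-1)}[B_r^{(r-1)}]^\dagger)B_j^{(r-1)}$. Finally $E=E_1\cdots E_{p-1}$ (the identity if $p=1$). Block reduction of $C$: set $C_j^{(0)}=C_j$ for $j=1,\dots,q$. For $r=1,\dots,q-1$ successively, and for $j=r+1,\dots,q$, set $$C_j^{(r)}=C_j^{(r-1)}\left(I-[C_r^{(r-1)}]^\dagger C_r^{(r-1)}\right).$$ For $r=1,\dots,q-1$, $F_r\in\mathbb C^{h\times h}$ is the block lower triangular matrix, partitioned conformally with $h=h_1+\cdots+h_q$, whose diagonal blocks are identity matrices, whose $(j,r)$ block is $-C_j^{(r-1)}[C_r^{(r-1)}]^\dagger$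 for each $j=r+1,\dots,q$, and whose other off-diagonal blocks are zero. Then $F=F_{q-1}\cdots F_1$ (the identity if $q=1$), $D_{C,rr}=C_r^{(r-1)}[C_r^{(r-1)}]^*$ for $r=1,\dots,q$, and $D_C^\dagger=\operatorname{diag}[D_{C,11}^\dagger,\dots,D_{C,qq}^\dagger]$. *)

(* Defs.v *)
From mathcomp Require Import all_boot all_order all_algebra.
From mathcomp Require Export sesquilinear spectral.
From mathcomp Require Export reals complex.

Set Implicit Arguments.
Unset Strict Implicit.
Unset Printing Implicit Defensive.

Import Order.TTheory GRing.Theory Num.Theory.
Local Open Scope ring_scope.
Local Open Scope sesquilinear_scope.

Section MoorePenrose.
Variable C : numClosedFieldType.

Definition penrose m n (A : 'M[C]_(m, n)) (X : 'M[C]_(n, m)) : bool :=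
  [&& A *m X *m A == A, X *m A *m X == X,
      (A *m X)^t* == A *m X & (X *m A)^t* == X *m A].

Lemma trmxC_mul m n p (A : 'M[C]_(m, n)) (B : 'M[C]_(n, p)) :
  (A *m B)^t* = B^t* *m A^t*.
Proof. by rewrite trmx_mul map_mxM. Qed.

Lemma mulmx_trmxC_eq0 m n (M : 'M[C]_(m, n)) : M *m M^t* = 0 -> M = 0.
Proof.
move=> MM0; apply/row_matrixP => i; rewrite row0; apply/eqP/negPn/negP.
move=> /dotmx_is_dotmx; rewrite dotmxE.
have -> : (row i M *m (row i M)^t*) 0 0 = (M *m M^t*) i i.
  by rewrite !mxE; apply: eq_bigr => k _; rewrite !mxE.
by rewrite MM0 mxE ltxx.
Qed.

Lemma gram_unit r n (M : 'M[C]_(r, n)) : row_free M -> M *m M^t* \in unitmx.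
Proof.
move=> freeM; rewrite -row_free_unit -kermx_eq0; apply/eqP.
set K := kermx _; have K0 : K *m (M *m M^t*) = 0 by exact: mulmx_ker.
apply/eqP; rewrite -(mulmx_free_eq0 _ freeM); apply/eqP.
by apply: mulmx_trmxC_eq0; rewrite trmxC_mul mulmxA -(mulmxA K) K0 mul0mx.
Qed.

Lemma penrose_exists m n (A : 'M[C]_(m, n)) : exists X, penrose A X.
Proof.
have [r [L [R [defA fullL freeR]]]] : exists r (L : 'M_(m, r)) (R : 'M_(r, n)),
    [/\ A = L *m R, row_full L & row_free R].
  exists (\rank A), (col_base A), (row_base A).
  by rewrite mulmx_base col_base_full row_base_free.
have uR : R *m R^t* \in unitmx by exact: gram_unit.
have uL : L^t* *m L \in unitmx.
  have /gram_unit : row_free (L^t*).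
    by rewrite /row_free mxrank_map mxrank_tr; exact: fullL.
  by rewrite trmxCK.
pose Ri := R^t* *m invmx (R *m R^t*); pose Li := invmx (L^t* *m L) *m L^t*.
have RRi : R *m Ri = 1%:M by rewrite mulmxA mulmxV.
have LiL : Li *m L = 1%:M by rewrite -mulmxA mulVmx.
have AX : A *m (Ri *m Li) = L *m Li.
  by rewrite defA -(mulmxA L R) (mulmxA R Ri) RRi mul1mx.
have XA : Ri *m Li *m A = Ri *m R.
  by rewrite defA -(mulmxA Ri Li) (mulmxA Li L) LiL mul1mx.
have invC k (M : 'M[C]_k) : (invmx M)^t* = invmx (M^t*).
  by rewrite trmx_inv map_invmx.
exists (Ri *m Li); apply/and4P; split; apply/eqP.
- by rewrite AX defA -(mulmxA L Li) (mulmxA Li L) LiL mul1mx.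
- by rewrite XA -(mulmxA Ri R) (mulmxA R Ri) RRi mul1mx.
- by rewrite AX !trmxC_mul invC trmxC_mul !trmxCK mulmxA.
- by rewrite XA !trmxC_mul invC trmxC_mul !trmxCK mulmxA.
Qed.

Lemma penrose_unique m n (A : 'M[C]_(m, n)) X1 X2 :
  penrose A X1 -> penrose A X2 -> X1 = X2.
Proof.
move=> /and4P[/eqP a1 /eqP b1 /eqP c1 /eqP d1].
move=> /and4P[/eqP a2 /eqP b2 /eqP c2 /eqP d2].
have AX : A *m X1 = A *m X2.
  have e : A *m X1 = A *m X2 *m (A *m X1) by rewrite mulmxA a2.
  by rewrite -c1 e trmxC_mul c1 c2 mulmxA a1.
have XA : X1 *m A = X2 *m A.
  have e : X1 *m A = X1 *m A *m (X2 *m A).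
    by rewrite -(mulmxA X1) (mulmxA A) a2.
  by rewrite -d1 e trmxC_mul d1 d2 -(mulmxA X2) (mulmxA A) a1.
by rewrite -b1 XA -mulmxA AX mulmxA b2.
Qed.

Definition mpinv m n (A : 'M[C]_(m, n)) : 'M[C]_(n, m) :=
  xchoose (penrose_exists A).

Lemma mpinvP m n (A : 'M[C]_(m, n)) : penrose A (mpinv A).
Proof. exact: xchooseP. Qed.

Definition frobenius m n (M : 'M[C]_(m, n)) : C :=
  sqrtC (\sum_i \sum_j `|M i j| ^+ 2).

End MoorePenrose.

(* Blocks are numbered from 0: block i : 'I_p is the block with index i + 1 in
   the usual 1-based numbering, while the stage superscript r of B^(r), C_j^(r)
   is unchanged.  So block i enters the reduction in its stage-i form: this is
   the block B_(i+1)^(i), and similarly for C. *)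

Section ColumnBlocks.
Variables (C : numClosedFieldType) (m p : nat) (g : 'I_p -> nat).
Variable B : 'M[C]_(m, \sum_i g i).

(* Built from M = B^(r), this is the factor that produces B^(r+1). *)
Definition col_elim (M : 'M[C]_(m, \sum_i g i)) (r : nat) :
    'M[C]_(\sum_i g i) :=
  1%:M + \mxblock_(i < p, j < p)
    (if (i == r :> nat) && (r < j)%N
     then - (mpinv (submxrow M i) *m submxrow M j) else 0).

Fixpoint col_stage (r : nat) : 'M[C]_(m, \sum_i g i) :=
  if r is r'.+1 then col_stage r' *m col_elim (col_stage r') r' else B.

Definition col_E : 'M[C]_(\sum_i g i) :=
  \big[mulmx/1%:M]_(r < p.-1) col_elim (col_stage r) r.

Definition col_D (i : 'I_p) : 'M[C]_(g i) :=
  (submxrow (col_stage i) i)^t* *m submxrow (col_stage i) i.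

Definition col_Dinv : 'M[C]_(\sum_i g i) := \mxdiag_(i < p) mpinv (col_D i).

End ColumnBlocks.

Section RowBlocks.
Variables (C : numClosedFieldType) (n q : nat) (h : 'I_q -> nat).
Variable M : 'M[C]_(\sum_j h j, n).

(* insubd j r is r seen in 'I_q whenever r < j.  For j <= r the stage-(r+1)
   block is a junk value, set equal to the stage-r block and never used. *)
Fixpoint row_stage (r : nat) (j : 'I_q) : 'M[C]_(h j, n) :=
  if r is r'.+1 then
    let P := row_stage r' (insubd j r') in
    if (r' < j)%N then row_stage r' j *m (1%:M - mpinv P *m P)
    else row_stage r' j
  else submxcol M j.

Definition row_elim (r : nat) : 'M[C]_(\sum_j h j) :=
  1%:M + \mxblock_(i < q, j < q)
    (if (j == r :> nat) && (r < i)%N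
     then - (row_stage r i *m mpinv (row_stage r j)) else 0).

(* rev_ord: the factor with the largest index comes leftmost. *)
Definition row_F : 'M[C]_(\sum_j h j) :=
  \big[mulmx/1%:M]_(r < q.-1) row_elim (rev_ord r).

Definition row_D (j : 'I_q) : 'M[C]_(h j) :=
  row_stage j j *m (row_stage j j)^t*.

Definition row_Dinv : 'M[C]_(\sum_j h j) := \mxdiag_(j < q) mpinv (row_D j).

End RowBlocks.

(* Main.v *)
(* The matrix [B E] has pairwise orthogonal column blocks, so [(B E)^* (B E)]
   is the block diagonal matrix [D_B] and [B E D_B^+ E^* B^*] fixes [B E].  As
   [E] is invertible it fixes [B], and since it is hermitian, [B^* B X_+] is
   [B^* Y].  The reduction of [C] is the adjoint of the reduction of the
   columns of [C^*], so the last equation follows from the same identity for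
   [C^*]. *)
Require Import Defs.
From mathcomp Require Import all_boot all_order all_algebra.
From HB Require Import structures.

Set Implicit Arguments.
Unset Strict Implicit.
Unset Printing Implicit Defensive.

Import Order.TTheory GRing.Theory Num.Theory.

Local Open Scope ring_scope.
Local Open Scope sesquilinear_scope.

HB.instance Definition _ (R : pzSemiRingType) (n : nat) :=
  Monoid.isLaw.Build 'M[R]_n 1%:M mulmx
    (@mulmxA R n n n n) (@mul1mx R n n) (@mulmx1 R n n).

(** * Adjoints of block matrices and of Moore-Penrose inverses *)

Section Adjoint.
Variable C : numClosedFieldType.

Lemma trmxCD m n (M N : 'M[C]_(m, n)) : (M + N)^t* = M^t* + N^t*.
Proof. by rewrite linearD map_mxD. Qed.

Lemma trmxCN m n (M : 'M[C]_(m, n)) : (- M)^t* = - M^t*.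
Proof. by rewrite linearN map_mxN. Qed.

Lemma trmxC0 m n : (0 : 'M[C]_(m, n))^t* = 0.
Proof. by rewrite trmx0 map_mx0. Qed.

Lemma trmxC1 n : (1%:M : 'M[C]_n)^t* = 1%:M.
Proof. by rewrite trmx1 map_mx1. Qed.

Lemma trmxC_submxrow m p (g : 'I_p -> nat) (M : 'M[C]_(m, \sum_i g i)) j :
  (submxrow M j)^t* = submxcol (M^t*) j.
Proof. by apply/matrixP => k l; rewrite !mxE. Qed.

Lemma trmxC_mxrow m p (g : 'I_p -> nat) (M_ : forall i, 'M[C]_(m, g i)) :
  (\mxrow_i M_ i)^t* = \mxcol_i (M_ i)^t*.
Proof. by apply/matrixP => k l; rewrite !mxE. Qed.

Lemma trmxC_mxblock p q (g : 'I_p -> nat) (h : 'I_q -> nat)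
    (M_ : forall i j, 'M[C]_(g i, h j)) :
  (\mxblock_(i, j) M_ i j)^t* = \mxblock_(j, i) (M_ i j)^t*.
Proof. by apply/matrixP => k l; rewrite !mxE. Qed.

Lemma trmxC_mxdiag p (g : 'I_p -> nat) (M_ : forall i, 'M[C]_(g i)) :
  (\mxdiag_i M_ i)^t* = \mxdiag_i (M_ i)^t*.
Proof.
rewrite trmxC_mxblock; apply/eq_mxblock => i j; rewrite eq_sym.
by case: eqVneq => [->|_]; rewrite ?conform_mx_id // trmxC0.
Qed.

(** The adjoint reverses products; the right-hand side has the shape in which [row_F] is defined. *)
Lemma trmxC_prod n k (M_ : 'I_k -> 'M[C]_n) :
  (\big[mulmx/1%:M]_(r < k) M_ r)^t* =
  \big[mulmx/1%:M]_(r < k) (M_ (rev_ord r))^t*.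
Proof.
elim: k M_ => [|k IHk] M_; first by rewrite !big_ord0 trmxC1.
rewrite big_ord_recr big_ord_recl trmxC_mul IHk /=; congr (_^t* *m _).
  by congr M_; apply: val_inj; rewrite /= subn1.
by apply: eq_bigr => r _; congr (_^t*); congr M_; apply: val_inj.
Qed.

(** Taking adjoints permutes the four Penrose conditions, so uniqueness applies. *)
Lemma mpinv_trmxC m n (M : 'M[C]_(m, n)) : mpinv (M^t*) = (mpinv M)^t*.
Proof.
apply: (penrose_unique (mpinvP _)).
have /and4P[/eqP a /eqP b /eqP c /eqP d] := mpinvP M.
by apply/and4P; split; apply/eqP;
  rewrite -!trmxC_mul ?mulmxA ?trmxCK ?a ?b ?c ?d.
Qed.

Lemma mpinvK m n (M : 'M[C]_(m, n)) : M *m mpinv M *m M = M.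
Proof. by have /and4P[/eqP] := mpinvP M. Qed.

(** Adjoint of [mpinvK], as [M *m mpinv M] is hermitian. It makes each reduced block orthogonal to
    its pivot block. *)
Lemma mul_trmxC_mpinv m n (M : 'M[C]_(m, n)) : M^t* *m M *m mpinv M = M^t*.
Proof.
have /and4P[/eqP MM _ /eqP herm _] := mpinvP M.
by rewrite -mulmxA -herm -trmxC_mul MM.
Qed.

(** The difference [N] of the two sides is killed by [M^t*] and has the form [M *m Z], hence
    [N^t* *m N = 0] and [N = 0]. *)
Lemma mul_mpinv_gram m n (M : 'M[C]_(m, n)) :
  M *m mpinv (M^t* *m M) *m (M^t* *m M) = M.
Proof.
apply/eqP; rewrite -subr_eq0; apply/eqP; set N := _ - M.
have MN : M^t* *m N = 0.
  by rewrite mulmxBr (mulmxA _ (M *m _)) (mulmxA _ M) mpinvK subrr.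
have NN : N^t* *m N = 0.
  rewrite {1}/N trmxCD trmxCN -mulmxA trmxC_mul mulmxBl.
  by rewrite -mulmxA MN mulmx0 subr0.
by rewrite -[N]trmxCK (mulmx_trmxC_eq0 (M := N^t*)) ?trmxC0 // trmxCK.
Qed.

End Adjoint.

(** * Orthogonality of the reduced column blocks *)

Section ColumnReduction.
Variables (C : numClosedFieldType) (m p : nat) (g : 'I_p -> nat).
Implicit Type M B : 'M[C]_(m, \sum_i g i).

Lemma ord_le_pred (i : 'I_p) : (i <= p.-1 < p)%N.
Proof.
have lt_ip := ltn_ord i; have p_gt0 := leq_ltn_trans (leq0n i) lt_ip.
by rewrite -ltnS prednK // lt_ip leqnn.
Qed.

Lemma submxrow_col_elim M (r j : 'I_p) :
  submxrow (M *m col_elim M r) j =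
  if (r < j)%N
  then submxrow M j - submxrow M r *m mpinv (submxrow M r) *m submxrow M j
  else submxrow M j.
Proof.
rewrite mulmxDr mulmx1 submxrowD -{2}[M]submxrowK mul_mxrow_mxblock mxrowK.
rewrite (bigD1 r) //= eqxx /= big1 ?addr0; last first.
  by move=> i /negPf ir; rewrite (inj_eq val_inj) ir mulmx0.
by case: ifP => _; rewrite ?mulmx0 ?addr0 // mulmxN mulmxA.
Qed.

(* The strictly triangular part of [col_elim M r] squares to 0. *)
Lemma col_elim_unit M r : col_elim M r \in unitmx.
Proof.
rewrite /col_elim; set N := mxblock _.
have NN : N *m N = 0.
  rewrite mul_mxblock -[RHS]mxblock0; apply/eq_mxblock => i k.
  rewrite big1 // => j _; case: ifP => [/andP[_ rj]|_]; last by rewrite mul0mx.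
  by rewrite (gtn_eqF rj) mulmx0.
suff /mulmx1_unit[] : (1%:M + N) *m (1%:M - N) = 1%:M by [].
by rewrite mulmxDl mul1mx mulmxBr mulmx1 NN subr0 subrK.
Qed.

Lemma col_E_unit B : col_E B \in unitmx.
Proof.
apply: (big_ind (fun M : 'M[C]_(\sum_i g i) => M \in unitmx)).
- exact: unitmx1.
- by move=> M N uM uN; rewrite unitmx_mul uM.
- by move=> r _; exact: col_elim_unit.
Qed.

Lemma mul_col_E B : B *m col_E B = col_stage B p.-1.
Proof.
rewrite /col_E; elim: p.-1 => [|k IHk]; first by rewrite big_ord0 mulmx1.
by rewrite big_ord_recr /= mulmxA IHk.
Qed.

(** Elimination [r] alters only blocks of index above [r], so block [i] is final from stage [i]
    on. *)
Lemma submxrow_col_stage B (i : 'I_p) r : (i <= r < p)%N ->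
  submxrow (col_stage B r) i = submxrow (col_stage B i) i.
Proof.
case/andP; elim: r => [|r IHr]; first by rewrite leqn0 => /eqP->.
rewrite leq_eqVlt ltnS => /predU1P[-> //|ir] rp.
rewrite -IHr //; last exact: ltnW.
by rewrite (submxrow_col_elim _ (Ordinal (ltnW rp))) /= ltnNge ir.
Qed.

(** The bound [i < r] says that block [i] has already served as pivot. Each elimination makes its
    pivot orthogonal to the later blocks and preserves the orthogonality obtained from earlier
    pivots. *)
Lemma col_stage_orthogonal B r (i j : 'I_p) : (i < r <= p)%N -> i != j ->
  (submxrow (col_stage B r) i)^t* *m submxrow (col_stage B r) j = 0.
Proof.
elim: r i j => [//|r IHr] i j /andP[ir rp] nij /=; set M := col_stage B r.
rewrite !(submxrow_col_elim _ (Ordinal rp)) /= [(r < i)%N]ltnNge -ltnS ir /=.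
move: ir; rewrite ltnS leq_eqVlt => /orP[/eqP ir|ir].
  have -> : i = Ordinal rp by apply: val_inj.
  case: ltnP => [_|jr]; first by rewrite mulmxBr !mulmxA mul_trmxC_mpinv subrr.
  (* Here [j] is an earlier pivot than [i], so the induction hypothesis applies to the adjoint
     product. *)
  rewrite -[LHS]trmxCK trmxC_mul trmxCK IHr ?trmxC0 //; last first.
    by rewrite eq_sym; apply: contra nij => /eqP <-; rewrite -val_eqE /= ir.
  rewrite ltn_neqAle jr (ltnW rp) !andbT -ir.
  by apply: contra nij => /eqP e; apply/eqP/val_inj.
(* An earlier pivot is orthogonal both to block [j] and to the multiple of block [r] subtracted from
   it. *)
have orth k : i != k -> (submxrow M i)^t* *m submxrow M k = 0.
  by move=> nik; apply: IHr => //; rewrite ir ltnW.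
case: ifP => _; last exact: orth.
rewrite mulmxBr !mulmxA !orth // ?mul0mx ?subrr //.
by rewrite -val_eqE /= ltn_eqF.
Qed.

Lemma mul_trmxC_col_E B :
  (B *m col_E B)^t* *m (B *m col_E B) = \mxdiag_i col_D B i.
Proof.
rewrite mul_col_E -[col_stage B p.-1]submxrowK trmxC_mxrow mul_mxcol_mxrow.
have stageE (i : 'I_p) := submxrow_col_stage B (ord_le_pred i).
apply/eq_mxblock => i j; case: (eqVneq i j) => [->|nij].
  by rewrite conform_mx_id stageE.
(* The last block is not a pivot before stage [p.-1]; taking [i < j] ensures that [i] is one. *)
wlog ij : i j nij / (i < j)%N.
  move=> wl; have := nij; rewrite -val_eqE neq_ltn => /orP[|ji].
    exact: wl.
  by rewrite -[LHS]trmxCK trmxC_mul trmxCK wl ?trmxC0 // eq_sym.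
apply: col_stage_orthogonal => //; have /andP[jp pp] := ord_le_pred j.
by rewrite (leq_trans ij jp) ltnW.
Qed.

Lemma trmxC_col_Dinv B : (col_Dinv B)^t* = col_Dinv B.
Proof.
rewrite trmxC_mxdiag; apply: eq_mxdiag => i.
by rewrite -mpinv_trmxC trmxC_mul trmxCK.
Qed.

(** After right multiplication by the invertible [col_E B], this is [mul_mpinv_gram] on each
    block. *)
Lemma col_projectorK B :
  B *m col_E B *m col_Dinv B *m (col_E B)^t* *m B^t* *m B = B.
Proof.
apply: (can_inj (mulmxK (col_E_unit B))).
have -> : B *m col_E B *m col_Dinv B *m (col_E B)^t* *m B^t* *m B *m col_E B =
    B *m col_E B *m col_Dinv B *m ((B *m col_E B)^t* *m (B *m col_E B)).
  by rewrite trmxC_mul !mulmxA.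
rewrite mul_trmxC_col_E mul_col_E -[col_stage B p.-1]submxrowK.
rewrite !mul_mxrow_mxdiag; apply: eq_mxrow => i.
by rewrite submxrow_col_stage ?ord_le_pred ?mul_mpinv_gram.
Qed.

Lemma trmxC_col_projectorK B :
  B^t* *m B *m col_E B *m col_Dinv B *m (col_E B)^t* *m B^t* = B^t*.
Proof.
apply: (can_inj (@trmxCK _ _ _)); rewrite !trmxC_mul !trmxCK trmxC_col_Dinv.
by rewrite !mulmxA col_projectorK.
Qed.

End ColumnReduction.

(** * The row reduction as the adjoint of a column reduction *)

Section RowReduction.
Variables (C : numClosedFieldType) (n q : nat) (h : 'I_q -> nat).
Variable M : 'M[C]_(\sum_j h j, n).

Lemma submxrow_col_stage_trmxC r j : (r <= q)%N ->
  submxrow (col_stage (M^t*) r) j = (row_stage M r j)^t*.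
Proof.
elim: r j => [|r IHr] j rq.
  by rewrite -[LHS]trmxCK trmxC_submxrow trmxCK.
rewrite /= (submxrow_col_elim _ (Ordinal rq)) /=.
(* Since [r < q], the default value [j] is not taken. *)
have -> : insubd j r = Ordinal rq by apply: val_inj; rewrite val_insubd rq.
rewrite !IHr ?(ltnW rq) //; case: ifP => // _.
set P := row_stage M r _; rewrite trmxC_mul trmxCD trmxCN trmxC1 trmxC_mul.
by rewrite mulmxBl mul1mx mpinv_trmxC.
Qed.

Lemma row_elim_trmxC r : (r < q)%N ->
  row_elim M r = (col_elim (col_stage (M^t*) r) r)^t*.
Proof.
move=> rq; rewrite trmxCD trmxC1 trmxC_mxblock; congr (_ + _).
apply/eq_mxblock => i j; case: ifP => _; last by rewrite trmxC0.
rewrite !submxrow_col_stage_trmxC ?(ltnW rq) // trmxCN mpinv_trmxC.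
by rewrite trmxC_mul !trmxCK.
Qed.

Lemma row_F_trmxC : row_F M = (col_E (M^t*))^t*.
Proof.
rewrite trmxC_prod; apply: eq_bigr => r _; apply: row_elim_trmxC.
exact: leq_trans (ltn_ord (rev_ord r)) (leq_pred q).
Qed.

Lemma row_Dinv_trmxC : row_Dinv M = col_Dinv (M^t*).
Proof.
apply: eq_mxdiag => j; congr mpinv.
by rewrite /col_D submxrow_col_stage_trmxC ?trmxCK // ltnW.
Qed.

Lemma row_projectorK :
  M^t* *m (row_F M)^t* *m row_Dinv M *m row_F M *m M *m M^t* = M^t*.
Proof.
rewrite row_F_trmxC row_Dinv_trmxC trmxCK.
by have := col_projectorK (M^t*); rewrite trmxCK.
Qed.

End RowReduction.

(** * Normal equation, minimality and the two-sided equation *)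

Lemma frobenius_ge0 (C : numClosedFieldType) m n (M : 'M[C]_(m, n)) :
  0 <= frobenius M.
Proof.
by rewrite sqrtC_ge0; do 2!apply: sumr_ge0 => ? _; rewrite exprn_ge0.
Qed.

Lemma frobenius0 (C : numClosedFieldType) m n :
  frobenius (0 : 'M[C]_(m, n)) = 0.
Proof.
rewrite /frobenius big1 ?sqrtC0 // => i _; apply: big1 => j _.
by rewrite mxE normr0 expr0n.
Qed.

Theorem theorem3 (R : realType) (m n p q : nat)
    (g : 'I_p -> nat) (h : 'I_q -> nat)
    (A : 'M[R[i]]_(m, n))
    (B : 'M[R[i]]_(m, \sum_(i < p) g i))
    (C : 'M[R[i]]_(\sum_(j < q) h j, n))
    (Y : 'M[R[i]]_(m, \sum_(j < q) h j)) :
  let E := col_E B in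
  let F := row_F C in
  let Xp : 'M[R[i]]_(\sum_(i < p) g i, \sum_(j < q) h j) :=
    E *m col_Dinv B *m E^t* *m B^t* *m Y in
  [/\ B^t* *m B *m Xp = B^t* *m Y,
      forall X : 'M[R[i]]_(\sum_(i < p) g i, \sum_(j < q) h j),
        frobenius (B^t* *m Y - B^t* *m B *m Xp)
          <= frobenius (B^t* *m Y - B^t* *m B *m X)
    & Y = A *m C^t* *m F^t* *m row_Dinv C *m F ->
      B^t* *m B *m Xp *m C *m C^t* = B^t* *m A *m C^t*].
Proof.
move=> E F Xp; have normal_eq : B^t* *m B *m Xp = B^t* *m Y.
  by rewrite /Xp /E !mulmxA trmxC_col_projectorK.
split=> [|X|defY]; first exact: normal_eq.
  (* The residual at [Xp] is zero, the least value a norm can take. *)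
  by rewrite normal_eq subrr frobenius0 frobenius_ge0.
rewrite normal_eq defY; have := row_projectorK C.
(* Associating to the right exposes the left side of [row_projectorK] behind [B^t* *m A]. *)
by rewrite -/F -!mulmxA => ->.
Qed.
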